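(* Let $\varepsilon>0$ be a constant. A randomized $O(n^{1-\varepsilon})$-competitive online graph coloring algorithm must read at least $\Omega(n\log n)$ bits of advice on inputs with $n$ vertices.
   Context: Online graph coloring: the vertices of a graph arrive one at a time, each together with its edges to previously revealed vertices ($n$ is the number of vertices); each vertex must irrevocably be assigned a color different from the colors of its already-revealed neighbors; the cost is the number of distinct colors used and $\mathrm{OPT}$ is the chromatic number. Advice is read from an infinite tape prepared by an oracle knowing the whole input; a randomized algorithm with advice complexity $b(n)$ is a probability distribution over deterministic algorithms with advice complexity at most $b(n)$. An algorithm $R$ is $c(n)$-competitive if there is a constant $\alpha$ with $\mathbb{E}[R(\sigma)]\leq c(n)\,\mathrm{OPT}(\sigma)+\alpha$ for all inputs $\sigma$ of length $n$. *)

(* Defs.v *)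
From HB Require Import structures.
From mathcomp Require Import all_boot all_order all_algebra.
From mathcomp Require Import all_classical all_reals all_analysis.
Set Implicit Arguments. Unset Strict Implicit. Unset Printing Implicit Defensive.
Import Order.TTheory GRing.Theory Num.Theory.

(* An input sigma with n = size sigma vertices: vertex i (0 <= i < n) is   *)
(* revealed at time i, together with its edges to the previously revealed  *)
(* vertices j < i: the edge {i,j} (j < i) is present iff                   *)
(* nth false (nth [::] sigma i) j.                                          *)
Definition graph_input := seq (seq bool).

Definition adj (s : graph_input) (i j : nat) : bool :=
  (j < i) && nth false (nth [::] s i) j.

Definition reveal (s : graph_input) (i : nat) : seq (seq bool) :=
  [seq [seq adj s k j | j <- iota 0 k] | k <- iota 0 i.+1].

Definition tape := nat -> bool.

(* A deterministic online algorithm with advice: when a vertex is revealed,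
   given the advice tape and everything revealed so far, it outputs
   (color of the new vertex, total number of advice bits read so far);
   together with the oracle preparing the tape from the whole input. *)
Record advice_alg := AdviceAlg {
  run : tape -> seq (seq bool) -> nat * nat ;
  oracle : graph_input -> tape
}.

(* The output of a step (and the number of bits read) depends only on the
   bits the algorithm has read: this models adaptive reading of the tape. *)
Definition reads_prefix (A : advice_alg) : Prop :=
  forall (phi psi : tape) (p : seq (seq bool)),
    (forall k, k < (run A phi p).2 -> phi k = psi k) ->
    run A phi p = run A psi p.

Definition color (A : advice_alg) (s : graph_input) (i : nat) : nat :=
  (run A (oracle A s) (reveal s i)).1.

Definition bits_read (A : advice_alg) (s : graph_input) (i : nat) : nat :=
  (run A (oracle A s) (reveal s i)).2.

Definition proper_online (A : advice_alg) : Prop :=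
  forall (s : graph_input) (i j : nat), i < size s -> adj s i j ->
    color A s i != color A s j.

Definition advice_complexity_le (A : advice_alg) (b : nat -> nat) : Prop :=
  forall (s : graph_input) (i : nat), i < size s -> bits_read A s i <= b (size s).

Definition det_advice_alg (A : advice_alg) (b : nat -> nat) : Prop :=
  [/\ reads_prefix A, proper_online A & advice_complexity_le A b].

Definition cost (A : advice_alg) (s : graph_input) : nat :=
  size (undup [seq color A s i | i <- iota 0 (size s)]).

Definition colorable (s : graph_input) (k : nat) : bool :=
  [exists f : {ffun 'I_(size s) -> 'I_k},
     [forall i : 'I_(size s), forall j : 'I_(size s),
        adj s i j ==> (f i != f j)]].

Lemma colorable_size (s : graph_input) : colorable s (size s).
Proof.
apply/existsP; exists [ffun i => i]; apply/forallP => i; apply/forallP => j.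
apply/implyP => /andP [ji _]; rewrite !ffunE.
by apply/negP => /eqP ij; move: ji; rewrite ij ltnn.
Qed.

Lemma colorable_ex (s : graph_input) : exists k, colorable s k.
Proof. by exists (size s); exact: colorable_size. Qed.

Definition chromatic_number (s : graph_input) : nat := ex_minn (colorable_ex s).

Local Open Scope ring_scope.

Definition randomized_advice_alg (R : realType) (d : measure_display)
  (Omega : measurableType d) (P : probability Omega R)
  (A : Omega -> advice_alg) (b : nat -> nat) : Prop :=
  (forall w, det_advice_alg (A w) b) /\
  (forall s : graph_input,
     measurable_fun setT (fun w => ((cost (A w) s)%:R : R))).

Definition expected_cost (R : realType) (d : measure_display)
  (Omega : measurableType d) (P : probability Omega R)
  (A : Omega -> advice_alg) (s : graph_input) : \bar R :=
  (\int[P]_w ((cost (A w) s)%:R : R)%:E)%E.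

Definition competitive (R : realType) (d : measure_display)
  (Omega : measurableType d) (P : probability Omega R)
  (A : Omega -> advice_alg) (c : nat -> R) : Prop :=
  exists alpha : R, forall s : graph_input,
    (expected_cost P A s <= (c (size s) * (chromatic_number s)%:R + alpha)%:E)%E.

(* Main.v *)
(** Each vertex carries a uniformly random assignment [x : 'I_q -> bool] and a
    uniformly random index [j]; the [i]-th vertex is adjacent to the earlier
    [l]-th one iff [x_i] and [x_l] disagree at [j_l].  The pair [(j, x j)] is a
    proper coloring with [2 q] colors, but [j] stays hidden when the vertex
    arrives.  A fixed online algorithm must put the new vertex in a color class
    whose [x_l j_l] all agree with [x]: a class that has already seen more than
    [h] indices is compatible with at most a fraction [2 ^ - h] of the
    assignments [x], and in any other class the hidden index is new except with
    probability [h / q].  So a step repeats a pair (color, index) with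
    probability at most [1 / T], while using only [m] colors forces [n - m q]
    repetitions.  For [q] and [T] small powers of [n] this has probability
    [2 ^ - Omega (n log n)], which survives a union bound over the [2 ^ b n]
    advice strings unless [b n = Omega (n log n)]. *)
Require Import Defs.
From HB Require Import structures.
From mathcomp Require Import all_boot all_order all_algebra.
From mathcomp Require Import all_classical all_reals all_analysis.
From mathcomp Require Import measurable_realfun zify ring lra.
Import Order.TTheory GRing.Theory Num.Theory.

(** * Counting colored runs of random vertices *)

Definition vertex (q : nat) : finType := ({ffun 'I_q -> bool} * 'I_q)%type.

(* Histories are lists with the most recent vertex first. *)
Fixpoint trace {q} (f : seq (vertex q) -> {ffun 'I_q -> bool} -> nat)
    (l : seq (vertex q)) : seq (nat * vertex q) :=
  if l is v :: l' then (f l' v.1, v) :: trace f l' else [::].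

Definition compat {q} (c : nat) (x : {ffun 'I_q -> bool})
    (t : seq (nat * vertex q)) : bool :=
  all (fun u : nat * ({ffun 'I_q -> bool} * 'I_q) => (u.1 == c) ==> (x u.2.2 == u.2.1 u.2.2)) t.

Definition bin_indices {q} (c : nat) (t : seq (nat * vertex q)) : {set 'I_q} :=
  [set j | (c, j) \in [seq (u.1, u.2.2) | u <- t]].

(* [0] as soon as a step is improper, otherwise [T] to the number of repeated
   (color, index) pairs: the exponential moment of the number of repetitions. *)
Fixpoint weight {q} (T : nat) f (l : seq (vertex q)) : nat :=
  if l is v :: l' then
    let c := f l' v.1 in
    compat c v.1 (trace f l') *
      (if v.2 \in bin_indices c (trace f l') then T else 1) * weight T f l'
  else 1.

Fixpoint all_seqs (V : finType) (n : nat) : seq (seq V) :=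
  if n is n'.+1 then [seq v :: l | v <- enum V, l <- all_seqs V n'] else [:: [::]].

Lemma size_trace q f (l : seq (vertex q)) : size (trace f l) = size l.
Proof. by elim: l => //= v l ->. Qed.

Lemma all_seqsP (V : finType) n l : l \in all_seqs V n -> size l = n.
Proof.
elim: n l => [|n IHn] l /=; first by rewrite inE => /eqP ->.
by case/allpairsP=> -[v l'] [_ /IHn Hl ->] /=; rewrite Hl.
Qed.

Lemma size_all_seqs (V : finType) n : size (all_seqs V n) = #|V| ^ n.
Proof. by elim: n => //= n IHn; rewrite size_allpairs IHn -cardE expnS. Qed.

Lemma card_vertex q : #|vertex q| = 2 ^ q * q.
Proof. by rewrite card_prod card_ffun card_bool !card_ord. Qed.

(** Two compatible assignments agree on [bin_indices c t], since a recorded vertex of color [c]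
    dictates each value there. Only the other coordinates are free. *)
Lemma card_compat q c (t : seq (nat * vertex q)) :
  #|[set x | compat c x t]| * 2 ^ #|bin_indices c t| <= 2 ^ q.
Proof.
have [->|[y]] := set_0Vmem [set x | compat c x t]; first by rewrite cards0.
rewrite inE => yt; set D := bin_indices c t.
pose F (j : 'I_q) : pred bool := if j \in D then pred1 (y j) else predT.
have sub : [set x | compat c x t] \subset family F.
  apply/fintype.subsetP => x; rewrite inE => xt; apply/familyP => j.
  rewrite /F; case: ifP => // /[!inE] /mapP [u ut [cu ju]].
  move/allP: xt => /(_ u ut); move/allP: yt => /(_ u ut).
  by rewrite -cu eqxx -ju => /eqP -> /eqP ->.
apply: (@leq_trans (#|family F| * 2 ^ #|D|)); first by rewrite leq_mul2r subset_leq_card ?orbT.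
rewrite card_family foldrE big_map big_enum /=.
rewrite -[X in _ * X]prod_nat_const [X in _ * X]big_mkcond -big_split /=.
rewrite -[X in _ <= 2 ^ X](card_ord q) -prod_nat_const; apply: leq_prod => j _.
by rewrite /F; case: (j \in D); rewrite ?card1 ?card_bool.
Qed.

(* Threshold [h]: classes with at most [h] indices are bounded by [h], larger ones by [card_compat]. *)
Lemma card_repeat q h (g : {ffun 'I_q -> bool} -> nat) (t : seq (nat * vertex q)) :
  #|[set v : vertex q | compat (g v.1) v.1 t & v.2 \in bin_indices (g v.1) t]| * 2 ^ h
  <= 2 ^ q * h * 2 ^ h + q * (size t * 2 ^ q).
Proof.
pose B := [set x | compat (g x) x t & h < #|bin_indices (g x) t|].
have leB : #|B| * 2 ^ h <= size t * 2 ^ q.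
  pose S c := if h < #|bin_indices c t| then [set x | compat c x t] else finset.set0.
  have sub : B \subset \bigcup_(u <- t) S u.1.
    apply/fintype.subsetP => x; rewrite inE => /andP [xt hx].
    (* A class with more than [h] indices is nonempty, so its color occurs in [t] and a union over
       the entries of [t] suffices. *)
    have [j] : exists j, j \in bin_indices (g x) t.
      by apply/card_gt0P; apply: leq_trans hx.
    rewrite inE => /mapP [u ut [gu _]].
    rewrite (big_rem u) //= inE; apply/orP; left.
    by rewrite /S -gu hx inE.
  have cardS c : #|S c| * 2 ^ h <= 2 ^ q.
    rewrite /S; case: ifP => [hc|_]; last by rewrite cards0.
    apply: leq_trans (card_compat q c t).
    by rewrite leq_mul2l leq_exp2l // (ltnW hc) orbT.
  apply: (@leq_trans ((\sum_(u <- t) #|S u.1|) * 2 ^ h)).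
    rewrite leq_mul2r; apply/orP; right.
    apply: leq_trans (subset_leq_card sub) _.
    elim/big_ind2: _ => [|X a Y b leX leY|//]; first by rewrite cards0.
    by apply: leq_trans (leq_card_setU _ _) _; apply: leq_add.
  rewrite big_distrl /= -sum1_size big_distrl /=.
  by apply: leq_sum => u _; rewrite mul1n.
have le1 : #|[set v : vertex q | compat (g v.1) v.1 t & v.2 \in bin_indices (g v.1) t]|
    <= 2 ^ q * h + q * #|B|.
  rewrite -sum1_card.
  rewrite (eq_bigl (fun v : vertex q => compat (g v.1) v.1 t && (v.2 \in bin_indices (g v.1) t)));
    last by move=> v; rewrite inE.
  rewrite -(pair_big_dep (fun x => compat (g x) x t) (fun x j => j \in bin_indices (g x) t) (fun _ _ => 1)) /=.
  have -> : 2 ^ q * h + q * #|B| = \sum_(x : {ffun 'I_q -> bool}) (h + q * (x \in B)).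
    rewrite big_split /= sum_nat_const card_ffun card_bool card_ord; congr (_ + _).
    rewrite -big_distrr /=; congr (_ * _).
    by rewrite -sum1_card big_mkcond; apply: eq_bigr => x _; case: (x \in B).
  rewrite big_mkcond; apply: leq_sum => x _; case: ifP => // cx.
  rewrite sum1_card inE cx /=; case: ltnP => hx.
    by rewrite muln1; apply: leq_trans (max_card _) _; rewrite card_ord leq_addl.
  by rewrite muln0 addn0.
apply: leq_trans (leq_mul le1 (leqnn _)) _.
by rewrite mulnDl leq_add2l -mulnA leq_mul2l leB orbT.
Qed.

(** By [card_repeat] the fraction of vertices in [Bad] is at most [h / q + n / 2 ^ h]. The two
    hypotheses bound each term by [1 / (2 T)], so the factor [T] on [Bad] adds at most 1 to the
    average. *)
Lemma sum_weight_step q T h n f (l : seq (vertex q)) :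
  2 * (T * h) <= q -> 2 * (T * n) <= 2 ^ h -> size l <= n ->
  \sum_(v : vertex q) weight T f (v :: l) <= 2 * #|vertex q| * weight T f l.
Proof.
move=> Th Tn ln /=.
rewrite -big_distrl leq_mul2r; apply/orP; right.
set t := trace f l.
set Bad := [set v : vertex q | compat (f l v.1) v.1 t & v.2 \in bin_indices (f l v.1) t].
apply: (@leq_trans (\sum_(v : vertex q) (1 + T * (v \in Bad)))).
  apply: leq_sum => v _; rewrite [v \in Bad]finset.in_set.
  by case: (compat _ _ _) => /=; case: (_ \in _); rewrite ?mul1n ?muln1 ?leq_addl.
rewrite big_split /= sum1_card -big_distrr /=.
have -> : \sum_(v : vertex q) (v \in Bad : nat) = #|Bad|.
  by rewrite -sum1_card [RHS]big_mkcond; apply: eq_bigr => x _; case: (x \in Bad).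
rewrite mul2n -addnn leq_add2l card_vertex.
have := card_repeat q h (f l) t; rewrite -/Bad size_trace => bad.
rewrite -(@leq_pmul2r (2 * 2 ^ h)) ?muln_gt0 ?expn_gt0 //.
move: bad; set a := #|Bad|; set e := 2 ^ h in Tn *; set N := 2 ^ q; move => bad.
have H1 : 2 * T * (a * e) <= 2 * T * (N * h * e + q * (size l * N)) by rewrite leq_mul2l bad orbT.
have H2 : 2 * (T * h) * (N * e) <= q * (N * e) by rewrite leq_mul2r Th orbT.
have H3 : 2 * (T * size l) <= e by apply: leq_trans Tn; rewrite !leq_mul2l ln !orbT.
have H4 : 2 * (T * size l) * (q * N) <= e * (q * N) by rewrite leq_mul2r H3 orbT.
clearbody a e N; nia.
Qed.

Lemma sum_weight q T h n f :
  2 * (T * h) <= q -> 2 * (T * n) <= 2 ^ h ->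
  \sum_(l <- all_seqs (vertex q) n) weight T f l <= (2 * #|vertex q|) ^ n.
Proof.
move=> Th Tn; suff: forall k, k <= n ->
    \sum_(l <- all_seqs (vertex q) k) weight T f l <= (2 * #|vertex q|) ^ k by apply.
elim=> [_|k IHk kn] /=; first by rewrite big_seq1.
rewrite big_allpairs_dep exchange_big /= expnS.
apply: leq_trans (leq_mul (leqnn _) (IHk (ltnW kn))).
rewrite big_distrr /= big_seq [X in _ <= X]big_seq; apply: leq_sum => l /all_seqsP sl.
by rewrite big_enum; apply: (sum_weight_step q T h n f l) => //; rewrite sl ltnW.
Qed.

Fixpoint valid_run {q} f (l : seq (vertex q)) : bool :=
  if l is v :: l' then compat (f l' v.1) v.1 (trace f l') && valid_run f l' else true.

(** Each valid step contributes one factor [T]: to the weight if its pair is a repetition, to the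
    power if the pair is new. *)
Lemma weight_valid_run q T f (l : seq (vertex q)) : valid_run f l ->
  weight T f l * T ^ size (undup [seq (u.1, u.2.2) | u <- trace f l]) = T ^ size l.
Proof.
elim: l => //= v l IHl /andP [-> /IHl IH]; rewrite mul1n inE.
case: ifP => _; first by rewrite -mulnA IH -expnS.
by rewrite mul1n /= expnS mulnCA IH -expnS.
Qed.

Lemma weight_few_colors q T f m (l : seq (vertex q)) : 0 < T -> valid_run f l ->
  size (undup [seq u.1 | u <- trace f l]) <= m ->
  T ^ size l <= weight T f l * T ^ (m * q).
Proof.
move=> T0 vl le_m; rewrite -(weight_valid_run _ _ _ _ vl) leq_mul2l leq_pexp2l ?orbT //.
apply: (@leq_trans (size [seq (c, j) | c <- undup [seq u.1 | u <- trace f l], j <- enum 'I_q])).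
  apply: uniq_leq_size (undup_uniq _) _ => -[c j]; rewrite mem_undup => /mapP [u ut [-> ->]].
  by apply: allpairs_f; rewrite ?mem_enum // mem_undup map_f.
by rewrite size_allpairs size_enum_ord leq_mul2r le_m orbT.
Qed.

(** * Vertex lists as online graph inputs *)

Definition seq_graph {q} (v0 : vertex q) (l : seq (vertex q)) : graph_input :=
  let V := nth v0 (rev l) in
  [seq [seq (V i).1 (V j).2 != (V j).1 (V j).2 | j <- iota 0 i] | i <- iota 0 (size l)].

Lemma size_seq_graph q (v0 : vertex q) l : size (seq_graph v0 l) = size l.
Proof. by rewrite size_map size_iota. Qed.

Lemma adj_seq_graph q (v0 : vertex q) l i j : i < size l ->
  adj (seq_graph v0 l) i j =
  (j < i) && ((nth v0 (rev l) i).1 (nth v0 (rev l) j).2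
              != (nth v0 (rev l) j).1 (nth v0 (rev l) j).2).
Proof.
move=> il; rewrite /adj; case: ltnP => //= ji.
by rewrite (nth_map 0) ?size_iota // nth_iota // (nth_map 0) ?size_iota // nth_iota.
Qed.

Lemma nth_rev_cat (T : Type) (x0 : T) (s1 s2 : seq T) i : i < size s2 ->
  nth x0 (rev (s1 ++ s2)) i = nth x0 (rev s2) i.
Proof. by move=> il; rewrite rev_cat nth_cat size_rev il. Qed.

Lemma nth_rev_cat_cons (T : Type) (x0 : T) (s1 s2 : seq T) x :
  nth x0 (rev (s1 ++ x :: s2)) (size s2) = x.
Proof. by rewrite rev_cat rev_cons cat_rcons nth_cat size_rev ltnn subnn. Qed.

(* At the arrival of a vertex its index is not visible yet; [v0.2] stands in for it. *)
Definition online_alg {q} (v0 : vertex q) (A : advice_alg) (t : tape)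
    (hist : seq (vertex q)) (x : {ffun 'I_q -> bool}) : nat :=
  (run A t (reveal (seq_graph v0 ((x, v0.2) :: hist)) (size hist))).1.

(** An edge is decided at the index of its earlier endpoint, so what is revealed up to [v] involves
    neither [v.2] nor the later vertices [l']. *)
Lemma reveal_seq_graph q (v0 v : vertex q) l' l :
  reveal (seq_graph v0 ((v.1, v0.2) :: l)) (size l) =
  reveal (seq_graph v0 (l' ++ v :: l)) (size l).
Proof.
apply/eq_in_map => i; rewrite mem_iota add0n ltnS => /andP [_ il].
apply/eq_in_map => j; rewrite mem_iota add0n => /andP [_ ji].
rewrite !adj_seq_graph /= ?size_cat /= ?ltnS //; last by rewrite addnS ltnS (leq_trans il) ?leq_addl.
rewrite ji /= -(cat1s v) catA -(cat1s (_, _)).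
rewrite !(nth_rev_cat _ _ _ l j) ?(leq_trans ji) //.
move: il; rewrite leq_eqVlt => /predU1P [->|il]; last by rewrite !nth_rev_cat.
by rewrite cat1s -catA cat1s (nth_rev_cat_cons _ _ [::]) nth_rev_cat_cons.
Qed.

Lemma mem_trace q f (l : seq (vertex q)) u : u \in trace f l ->
  exists l1 l2, l = l1 ++ u.2 :: l2 /\ u.1 = f l2 u.2.1.
Proof.
elim: l => //= v l IHl; rewrite inE => /predU1P [->|/IHl [l1 [l2 [-> ->]]]].
  by exists [::], l.
by exists (v :: l1), l2.
Qed.

Lemma reads_prefixP (A : advice_alg) b s (t : tape) : det_advice_alg A b ->
  (forall k, k < b (size s) -> oracle A s k = t k) ->
  forall i, i < size s -> color A s i = (run A t (reveal s i)).1.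
Proof.
move=> [rA _ cA] ot i si; rewrite /color (rA _ t) // => k kb.
by apply: ot; apply: leq_trans kb (cA _ _ si).
Qed.

Lemma color_online_alg q (v0 : vertex q) A b t l : det_advice_alg A b ->
  (forall k, k < b (size l) -> oracle A (seq_graph v0 l) k = t k) ->
  forall l1 v l2, l = l1 ++ v :: l2 ->
    online_alg v0 A t l2 v.1 = color A (seq_graph v0 l) (size l2).
Proof.
move=> dA ot l1 v l2 El; rewrite (reads_prefixP _ _ _ t dA) ?size_seq_graph //.
  by rewrite /online_alg (reveal_seq_graph _ _ v l1) El.
by rewrite El size_cat /= addnS ltnS leq_addl.
Qed.

(** Vertices of equal color are non-adjacent, which means that their assignments agree at the
    earlier index: this is [compat]. *)
Lemma valid_run_online_alg q (v0 : vertex q) A b t l : det_advice_alg A b ->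
  (forall k, k < b (size l) -> oracle A (seq_graph v0 l) k = t k) ->
  valid_run (online_alg v0 A t) l.
Proof.
move=> dA ot; have col := color_online_alg _ v0 A b t l dA ot.
(* The induction is over suffixes of a fixed [l], because the tape is tied to the whole input. *)
suff: forall l1 l2, l = l1 ++ l2 -> valid_run (online_alg v0 A t) l2 by move/(_ [::]); apply.
move=> l1 l2; elim: l2 l1 => //= v l2 IHl2 l1 El.
rewrite (IHl2 (rcons l1 v)) ?cat_rcons // andbT.
apply/allP => u /mem_trace [l3 [l4 [El2 ->]]]; apply/implyP => /eqP.
have El' : l = (l1 ++ v :: l3) ++ u.2 :: l4 by rewrite El El2 -catA.
rewrite (col _ _ _ El) (col _ _ _ El') => Ecol.
have [_ /(_ (seq_graph v0 l) (size l2) (size l4)) prop _] := dA.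
have l2l : size l2 < size l by rewrite El size_cat /= addnS ltnS leq_addl.
apply/negPn/negP => neq; move: prop; rewrite size_seq_graph l2l Ecol eqxx adj_seq_graph //.
have -> : nth v0 (rev l) (size l2) = v by rewrite El nth_rev_cat_cons.
have -> : nth v0 (rev l) (size l4) = u.2 by rewrite El' nth_rev_cat_cons.
rewrite neq El2 size_cat /= addnS ltnS leq_addl.
by move=> /(_ isT isT).
Qed.

Lemma colors_online_alg q (v0 : vertex q) A b t l : det_advice_alg A b ->
  (forall k, k < b (size l) -> oracle A (seq_graph v0 l) k = t k) ->
  size (undup [seq u.1 | u <- trace (online_alg v0 A t) l]) <= cost A (seq_graph v0 l).
Proof.
move=> dA ot; apply: uniq_leq_size (undup_uniq _) _ => c.
rewrite !mem_undup => /mapP [u /mem_trace [l1 [l2 [El ->]]] ->].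
rewrite (color_online_alg _ v0 A b t l dA ot _ _ _ El); apply: map_f.
by rewrite mem_iota size_seq_graph El size_cat /= addnS ltnS leq_addl.
Qed.

Lemma chromatic_seq_graph q (v0 : vertex q) l : chromatic_number (seq_graph v0 l) <= 2 * q.
Proof.
rewrite /chromatic_number; case: ex_minnP => m _; apply.
have -> : 2 * q = #|{: bool * 'I_q}| by rewrite card_prod card_bool card_ord.
apply/existsP; pose V := nth v0 (rev l).
exists [ffun i : 'I_(size (seq_graph v0 l)) => enum_rank ((V i).1 (V i).2, (V i).2)].
apply/forallP => i; apply/forallP => j; apply/implyP.
rewrite adj_seq_graph; last by rewrite -(size_seq_graph _ v0).
case/andP=> _ neq; rewrite !ffunE; apply: contra neq => /eqP /enum_rank_inj [Ex Ej].
by rewrite -Ex -Ej.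
Qed.

(** * Union bound over advice strings *)

(** Markov's inequality for [weight], summed over all strings of [b n] bits: a list colored cheaply
    has large weight under the string that its own oracle writes. *)
Lemma few_colors_count q (v0 : vertex q) A b T h m n :
  det_advice_alg A b -> 0 < T -> 2 * (T * h) <= q -> 2 * (T * n) <= 2 ^ h ->
  count (fun l => cost A (seq_graph v0 l) <= m) (all_seqs (vertex q) n) * T ^ n
  <= 2 ^ b n * (2 * #|vertex q|) ^ n * T ^ (m * q).
Proof.
move=> dA T0 Th Tn.
(* The default [false] fills the tape beyond the [b n] bits that can be read. *)
pose f (t : (b n).-tuple bool) := online_alg v0 A (nth false t).
rewrite -sum1_count big_distrl big_mkcond /=.
apply: (@leq_trans (\sum_(l <- all_seqs (vertex q) n)
    \sum_(t : (b n).-tuple bool) weight T (f t) l * T ^ (m * q))).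
  rewrite big_seq [X in _ <= X]big_seq; apply: leq_sum => l /all_seqsP sl.
  case: ifP => // cm; pose t := [tuple oracle A (seq_graph v0 l) i | i < b n].
  have ot k : k < b (size l) -> oracle A (seq_graph v0 l) k = nth false t k.
    by rewrite sl => kb; rewrite -[k]/(nat_of_ord (Ordinal kb)) -tnth_nth tnth_mktuple.
  rewrite (bigD1 t) //= mul1n -[in leqLHS]sl; apply: leq_trans (leq_addr _ _).
  apply: weight_few_colors => //; first exact: valid_run_online_alg dA ot.
  exact: leq_trans (colors_online_alg _ v0 _ _ _ _ dA ot) cm.
rewrite exchange_big /=.
have -> : 2 ^ b n = #|{: (b n).-tuple bool}| by rewrite card_tuple card_bool.
rewrite -mulnA -sum_nat_const; apply: leq_sum => t _.
by rewrite -big_distrl leq_mul2r /= (sum_weight q T h) ?orbT.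
Qed.

(** In the exponent, [n] absorbs the factor [2 ^ n] of [few_colors_count], and the extra 1 leaves at
    most half of the lists with cost at most [m]. *)
Lemma sum_cost_ge q (v0 : vertex q) A b T h m n :
  det_advice_alg A b -> 0 < T -> 2 * (T * h) <= q -> 2 * (T * n) <= 2 ^ h ->
  2 ^ (b n + n + 1) * T ^ (m * q) <= T ^ n ->
  m.+1 * #|vertex q| ^ n <= 2 * \sum_(l <- all_seqs (vertex q) n) cost A (seq_graph v0 l).
Proof.
move=> dA T0 Th Tn big; set E := all_seqs _ n.
have cnt := few_colors_count q v0 A b T h m n dA T0 Th Tn.
set K := count _ _ in cnt.
have leK : 2 * K <= #|vertex q| ^ n.
  rewrite -(@leq_pmul2r (T ^ n)) ?expn_gt0 ?T0 // -mulnA.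
  apply: (leq_trans (leq_mul (leqnn 2) cnt)).
  rewrite expnMn; move: big; rewrite !expnD expn1.
  set a := 2 ^ _; set c := 2 ^ n; set d := _ ^ _; set e := #|_| ^ n => big.
  have := leq_mul (leqnn e) big; clearbody a c d e; lia.
have Hsum : m.+1 * (size E - K) <= \sum_(l <- E) cost A (seq_graph v0 l).
  rewrite -(count_predC (fun l => cost A (seq_graph v0 l) <= m) E) -/K addKn.
  rewrite -sum1_count big_distrr big_mkcond; apply: leq_sum => l _ /=.
  by case: ifP => //; rewrite -ltnNge muln1.
apply: leq_trans (leq_mul (leqnn 2) Hsum).
by rewrite size_all_seqs mulnCA leq_mul2l; lia.
Qed.

(** * From deterministic to randomized algorithms, and asymptotic estimates *)

Local Open Scope ring_scope.

(** The easy direction of Yao's principle: exchange the sum over inputs with the integral over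
    algorithms. *)
Lemma sum_cost_le_expected (R : realType) (d : measure_display)
  (Omega : measurableType d) (P : probability Omega R)
  (A : Omega -> advice_alg) (b : nat -> nat) (ss : seq graph_input) (K : nat) (B : R) :
  randomized_advice_alg P A b ->
  (forall w, (K <= \sum_(s <- ss) cost (A w) s)%N) ->
  (forall s, s \in ss -> (expected_cost P A s <= B%:E)%E) ->
  K%:R <= (size ss)%:R * B.
Proof.
move=> [_ mA] leK leB.
have mc s : measurable_fun setT (fun w => ((cost (A w) s)%:R)%:E : \bar R).
  exact/measurable_EFinP/mA.
rewrite -lee_fin.
apply: (@le_trans _ _ (\sum_(s <- ss) expected_cost P A s)%E).
  rewrite -ge0_integral_sum //.
  rewrite -[leLHS]mule1 -(probability_setT P) -integral_cst //.
  apply: ge0_le_integral => //.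
  - by move=> w _; rewrite lee_fin.
  - by apply: emeasurable_sum => s; exact: mc.
  - by move=> w _; rewrite /cst sumEFin lee_fin -natr_sum ler_nat.
have -> : (size ss)%:R * B = \sum_(s <- ss) B.
  by rewrite big_const_seq count_predT iter_addr_0 mulr_natl.
rewrite -sumEFin.
by rewrite big_seq [leRHS]big_seq; apply: lee_sum => s sss; exact: leB.
Qed.

Lemma nat_root (e n : nat) : (0 < n)%N -> (0 < e)%N ->
  exists r, (0 < r)%N /\ (r ^ e <= n < r.+1 ^ e)%N.
Proof.
move=> n0 e0; have ex : exists r, (r ^ e <= n)%N by exists 1%N; rewrite exp1n.
have ub r : (r ^ e <= n)%N -> (r <= n)%N.
  apply: leq_trans; case: r => // r; rewrite -[X in (X <= _)%N]expn1.
  exact: leq_pexp2l.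
case: (ex_maxnP ex ub) => r rn max; exists r; split.
  by apply: max; rewrite exp1n.
by rewrite rn ltnNge; apply/negP => /max; rewrite ltnn.
Qed.

Lemma eventually_expn_le_exp2 (k : nat) :
  exists r0, forall r, (r0 <= r)%N -> ((2 * r) ^ k <= 2 ^ r./2)%N.
Proof.
case: k => [|k]; first by exists 0%N => r _; rewrite expn0 expn_gt0.
set K := k.+1; exists (64 * K ^ 2)%N => r hr.
(* Since [u.+1 <= 2 ^ u], the bound [2 * r <= u.+1 ^ 2] gives [(2 * r) ^ K <= 2 ^ (u * 2 * K)]. The
   divisor [4 * K] keeps this exponent below [r./2]. *)
pose u := ((r %/ (4 * K)))%N.
have hu : (2 * r <= u.+1 ^ 2)%N.
  have : (r < u.+1 * (4 * K))%N by rewrite /u ltn_ceil.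
  move: hr; rewrite /K -mulnn => hr.
  rewrite -mulnn; clearbody u; nia.
have huK : (u * 2 * K <= r./2)%N.
  have := leq_trunc_div r (4 * K); rewrite -/u.
  have := odd_double_half r; clearbody u; rewrite -muln2; case: (odd r); lia.
apply: leq_trans (leq_pexp2l _ huK) => //.
rewrite expnM leq_exp2r // (leq_trans hu) // expnM leq_exp2r //.
by rewrite ltn_expl.
Qed.

Lemma expected_cost_lower_bound (R : realType) (d : measure_display)
  (Omega : measurableType d) (P : probability Omega R)
  (A : Omega -> advice_alg) (b : nat -> nat) (q T h m n : nat) (B : R) :
  randomized_advice_alg P A b ->
  (0 < q)%N -> (0 < T)%N -> (2 * (T * h) <= q)%N -> (2 * (T * n) <= 2 ^ h)%N ->
  (2 ^ (b n + n + 1) * T ^ (m * q) <= T ^ n)%N ->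
  (forall s, size s = n -> (chromatic_number s <= 2 * q)%N ->
     (expected_cost P A s <= B%:E)%E) ->
  m.+1%:R <= 2 * B.
Proof.
move=> rA q0 T0 Th Tn big leB.
pose v0 : vertex q := ([ffun=> false], Ordinal q0).
pose ss := [seq seq_graph v0 l | l <- all_seqs (vertex q) n].
(* Listing the inputs twice absorbs the factor 2 of [sum_cost_ge]. *)
have := sum_cost_le_expected R d Omega P A b (ss ++ ss) (m.+1 * #|vertex q| ^ n) B rA.
have V0 : 0 < (#|vertex q| ^ n)%:R :> R.
  by rewrite ltr0n expn_gt0 card_vertex muln_gt0 expn_gt0 q0.
rewrite size_cat addnn -mul2n size_map size_all_seqs !natrM mulrAC ler_pM2r //; apply.
  move=> w; rewrite big_cat /= addnn -mul2n big_map.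
  by apply: (sum_cost_ge q v0 (A w) b T h) => //; case: rA.
move=> s; rewrite mem_cat orbb => /mapP [l /all_seqsP sl ->].
by apply: leB; rewrite ?size_seq_graph // chromatic_seq_graph.
Qed.

(** After squaring, one factor [r ^ n] pays for [r ^ (2 * k)] and the other for
    [2 ^ (2 * (b + n + 1))]. For the latter, [ln n <= 2 e ln r] gives [b <= n ln r / 4], and
    [ln r >= 8] handles [n + 1]. *)
Lemma few_advice_tapes (R : realType) (e r n b k : nat) :
  (0 < e)%N -> (0 < n)%N -> (n < r.+1 ^ e)%N -> (2 * k <= n)%N -> expR 8 <= r%:R :> R ->
  b%:R < (8 * e%:R)^-1 * (n%:R * ln n%:R) :> R ->
  (2 ^ (b + n + 1) * r ^ k <= r ^ n)%N.
Proof.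
move=> e0 n0 nr kn r8 bn.
have e0' : 0 < e%:R :> R by rewrite ltr0n.
have n1 : 1 <= n%:R :> R by rewrite ler1n.
have r1 : 1 < r%:R :> R by apply: lt_le_trans r8; rewrite expR_gt1.
have r2 : (1 < r)%N by rewrite -(ltr1n R).
have lnr : 8 <= ln r%:R :> R.
  by rewrite -[leLHS]expRK ler_ln // posrE ?expR_gt0 // ltr0n ltnW.
have ln2 : ln 2 <= 1 :> R.
  by have := @le_ln1Dx R 1; rewrite -[1 + 1]/(2%:R); apply; lra.
have lnn : ln n%:R <= 2 * e%:R * ln r%:R :> R.
  have -> : 2 * e%:R * ln r%:R = ln (r%:R ^+ (2 * e)) :> R.
    by rewrite lnXn ?ltr0n ?(ltnW r2) // -[RHS]mulr_natl natrM.
  rewrite -natrX ler_ln ?posrE ?ltr0n ?expn_gt0 ?(ltnW r2) // ler_nat.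
  apply: leq_trans (ltnW nr) _; rewrite expnM leq_exp2r // -mulnn; nia.
have tapes : (2 ^ (2 * (b + n + 1)) <= r ^ n)%N.
  rewrite -(ler_nat R) !natrX -ler_ln ?posrE ?exprn_gt0 ?ltr0n ?(ltnW r2) //.
  rewrite !lnXn ?ltr0n ?(ltnW r2) // -[leLHS]mulr_natl -[leRHS]mulr_natl.
  apply: (@le_trans _ _ ((2 * (b + n + 1))%N%:R)); first by rewrite ler_piMr.
  rewrite natrM !natrD.
  have H : (8 * e%:R)^-1 * (n%:R * ln n%:R) <= n%:R * ln r%:R / 4 :> R.
    rewrite mulrC ler_pdivrMr; last by lra.
    have -> : n%:R * ln r%:R / 4 * (8 * e%:R) = n%:R * (2 * e%:R * ln r%:R) :> R by field.
    by rewrite ler_wpM2l.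
  have H2 : n%:R * 8 <= n%:R * ln r%:R :> R by rewrite ler_wpM2l.
  by have := lt_le_trans bn H; lra.
rewrite -leq_sqr expnMn -!expnM ![(_ * 2)%N]mulnC.
by rewrite (mul2n n) -addnn expnD leq_mul // leq_pexp2l ?(ltnW r2).
Qed.

Lemma powR_root_le (R : realType) (eps : R) (e r n k : nat) :
  0 <= eps -> k%:R <= e%:R * eps -> (0 < r)%N -> (r ^ e <= n)%N ->
  n%:R `^ (1 - eps) * r%:R ^+ k <= n%:R.
Proof.
move=> eps0 ke r0 rn; have n0 : (0 < n)%N by apply: leq_trans rn; rewrite expn_gt0 r0.
have {2}-> : n%:R = n%:R `^ (1 - eps) * n%:R `^ eps :> R.
  by rewrite -powRD ?subrK ?powRr1 // pnatr_eq0 -lt0n n0 implybT.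
rewrite ler_wpM2l ?powR_ge0 // -powR_mulrn //.
apply: (@le_trans _ _ (r%:R `^ (e%:R * eps))); first by rewrite ler_powR // ler1n.
rewrite powRrM powR_mulrn // -natrX ge0_ler_powR ?nnegrE //.
by rewrite ler_nat.
Qed.

Theorem theorem5 (R : realType) (eps : R) (heps : 0 < eps)
  (d : measure_display) (Omega : measurableType d) (P : probability Omega R)
  (A : Omega -> advice_alg) (b : nat -> nat) :
  randomized_advice_alg P A b ->
  (exists c : nat -> R,
     (exists (C : R) (N : nat), forall n : nat, (N <= n)%N ->
        c n <= C * (n%:R `^ (1 - eps))) /\
     competitive P A c) ->
  exists (D : R) (N : nat), 0 < D /\
    forall n : nat, (N <= n)%N -> D * (n%:R * ln (n%:R)) <= (b n)%:R.
Proof.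
move=> rA [c [[C [N0 HC]] [alpha comp]]].
(* The 5 gives [n ^ (1 - eps) * r ^ 5 <= n]: four powers of [r] come from using [q = r ^ 2] twice,
   and the fifth beats [C]. The [.+3] gives [r ^ 3 <= n], which beats [alpha]. *)
pose e := (Num.bound (5 / eps)).+3.
have e5 : 5 <= e%:R * eps :> R.
  rewrite -ler_pdivrMr //; apply: le_trans (ltW (archi_boundP _)) _; first by rewrite divr_ge0 // ltW.
  by rewrite ler_nat; exact: (leq_addl 3).
(* The exponent [e.+1] fits [2 * (r * n) <= (2 * r) ^ e.+1], from [n < r.+1 ^ e]. *)
have [r1 Hr1] := eventually_expn_le_exp2 e.+1.
pose r0 := (r1 + Num.bound (expR 8 : R) + Num.bound (16 * `|C|) + Num.bound (8 * `|alpha|) + 1)%N.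
exists (8 * e%:R)^-1, (maxn N0 (r0 ^ e)); split; first by rewrite invr_gt0 mulr_gt0 // ltr0n.
move=> n; rewrite geq_max => /andP [N0n r0n].
have n0 : (0 < n)%N by apply: leq_trans r0n; rewrite expn_gt0 /r0 addn1.
have [//|r [rpos /andP [rn nr]]] := nat_root e n n0.
have r0r : (r0 <= r)%N by rewrite -ltnS -(@ltn_exp2r _ _ e) // (leq_ltn_trans r0n).
have r_bound (x : R) : 0 <= x -> (Num.bound x <= r0)%N -> x <= r%:R.
  move=> x0 xr; apply: le_trans (ltW (archi_boundP x0)) _.
  by rewrite ler_nat (leq_trans xr).
have r8 : expR 8 <= r%:R :> R by apply: r_bound; rewrite ?expR_ge0 ?mulr_ge0 // /r0; lia.
have rC : 16 * `|C| <= r%:R by apply: r_bound; rewrite ?expR_ge0 ?mulr_ge0 // /r0; lia.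
have ra : 8 * `|alpha| <= r%:R by apply: r_bound; rewrite ?expR_ge0 ?mulr_ge0 // /r0; lia.
rewrite leNgt; apply/negP => bn.
(* [r] is about [n ^ (1 / e)], and [m] is taken so that at least half of the steps must be repetitions. *)
pose q := (r ^ 2)%N; pose m := (n %/ (2 * q))%N.
have q0 : (0 < q)%N by rewrite expn_gt0 rpos.
have mq : (2 * (m * q) <= n)%N by rewrite mulnCA leq_trunc_div.
have H2 : (2 * (r * n) <= 2 ^ r./2)%N.
  apply: leq_trans (Hr1 r _); last by apply: leq_trans r0r; rewrite /r0; lia.
  rewrite expnS -mulnA !leq_mul2l (leq_trans (ltnW nr)) ?orbT //.
  by rewrite leq_exp2r // mul2n -addnn -addn1 leq_add2l.
have := expected_cost_lower_bound R d Omega P A b q r r./2 m n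
  (`|C| * n%:R `^ (1 - eps) * (2 * q)%:R + `|alpha|) rA q0 rpos _ H2
  (few_advice_tapes R e r n (b n) (m * q) isT n0 nr mq r8 bn).
have -> : (2 * (r * r./2) <= q)%N.
  by rewrite mulnCA /q -mulnn leq_mul2l mul2n -[leqRHS]odd_double_half leq_addl orbT.
move=> /(_ isT) H.
have {}H : m.+1%:R <= 2 * (`|C| * n%:R `^ (1 - eps) * (2 * q)%:R + `|alpha|).
  apply: H => s sn chi; apply: le_trans (comp s) _; rewrite lee_fin sn lerD ?ler_norm //.
  apply: (@le_trans _ _ (`|C| * n%:R `^ (1 - eps) * (chromatic_number s)%:R)).
    rewrite ler_wpM2r //; apply: le_trans (HC n N0n) _.
    by rewrite ler_wpM2r ?powR_ge0 ?ler_norm.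
  by rewrite ler_wpM2l ?ler_nat // mulr_ge0 ?powR_ge0.
have nm : n%:R < m.+1%:R * (2 * r%:R ^+ 2) :> R.
  by rewrite -natrX -!natrM ltr_nat ltn_ceil // muln_gt0 q0.
have pn := @powR_root_le R eps e r n 5 (ltW heps) e5 rpos rn.
have r3n : r%:R ^+ 3 <= n%:R :> R.
  by rewrite -natrX ler_nat (leq_trans _ rn) // leq_pexp2l.
move: H nm; rewrite natrM natrX.
set p := _ `^ _ in pn *; set x := r%:R : R in rC ra pn r3n *; set y := n%:R : R in pn r3n *.
have p0 : 0 <= p by apply: powR_ge0.
have x0 : 0 <= x by apply: ler0n.
move=> H nm.
have H1 : m.+1%:R * (2 * x ^+ 2) <= 2 * (`|C| * p * (2 * x ^+ 2) + `|alpha|) * (2 * x ^+ 2).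
  by rewrite ler_wpM2r // mulr_ge0 // exprn_ge0.
have H3 : (16 * `|C|) * (p * x ^+ 4) <= x * (p * x ^+ 4).
  by rewrite ler_wpM2r // mulr_ge0 // exprn_ge0.
have H4 : 8 * `|alpha| * x ^+ 2 <= x * x ^+ 2 by rewrite ler_wpM2r // exprn_ge0.
(* The strict upper bound on [n] splits into two terms, each at most [n / 2]: a contradiction. *)
have := lt_le_trans nm H1.
have -> : 2 * (`|C| * p * (2 * x ^+ 2) + `|alpha|) * (2 * x ^+ 2) =
  2^-1 * (16 * `|C| * (p * x ^+ 4)) + 2^-1 * (8 * `|alpha| * x ^+ 2) by field.
have E3 : x * (p * x ^+ 4) = p * x ^+ 5 by ring.
have E4 : x * x ^+ 2 = x ^+ 3 by ring.
move: H3 H4 pn r3n; rewrite E3 E4; clear; lra.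
Qed.
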